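(* Let $d\geqslant 3$ be an integer, let $h>0$ and let $0<p\leqslant q<\infty$. There is a constant $C=C(d,h,p,q)>0$, depending only on $d,h,p,q$, such that for every $d$-regular graph $G$ with Cheeger constant $h(G)=h$ and every metric space $\mathcal{M}=(M,\varrho)$ we have $$\gamma(G,\varrho^p)\leqslant C\,\max\big\{1,\gamma(G,\varrho^q)\big\}$$ and $$\gamma(G,\varrho^q)\leqslant C\,\gamma(G,\varrho^p)^{\frac{q}{p}}.$$
   Context: All graphs are finite and simple; $V_G$ and $E_G$ denote the vertex set and edge set of a graph $G$. For a $d$-regular graph $G$, a metric space $\mathcal{M}=(M,\varrho)$ and an exponent $p>0$, $\gamma(G,\varrho^p)$ denotes the smallest constant $\gamma\in(0,\infty]$ such that for every $f\colon V_G\to M$, $$\frac{1}{|V_G|^2}\sum_{v,u\in V_G}\varrho\big(f(v),f(u)\big)^p\leqslant\frac{\gamma}{|E_G|}\sum_{\{v,u\}\in E_G}\varrho\big(f(v),f(u)\big)^p,$$ where the left-hand sum is over all ordered pairs $(v,u)\in V_G\times V_G$. The Cheeger constant of $G$ is $$h(G):=\min_{\emptyset\neq S\subseteq V_G,\ |S|\leqslant |V_G|/2}\frac{\big|\big\{\{v,u\}\in E_G\colon v\in S,\ u\notin S\big\}\big|}{|S|}.$$ *)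

(* Defs.v *)
From mathcomp Require Import all_boot all_order all_algebra.
From mathcomp Require Import all_classical all_reals all_analysis.

Set Implicit Arguments.
Unset Strict Implicit.
Unset Printing Implicit Defensive.

Import Order.TTheory GRing.Theory Num.Theory.

Local Open Scope ring_scope.

Record sgraph := SGraph {
  vertex :> finType;
  adj : rel vertex;
  adj_sym : symmetric adj;
  adj_irrefl : irreflexive adj }.

(* An unordered edge {v, u} is represented by exactly one of the pairs (v, u)
   and (u, v): the one that is increasing in the enumeration of the vertices. *)
Definition edges (G : sgraph) : {set G * G} :=
  [set e | adj e.1 e.2 && (enum_rank e.1 < enum_rank e.2)%N].

Definition regular (G : sgraph) (d : nat) : Prop :=
  forall v : G, #|[set u | adj v u]| = d.

Definition edge_boundary (G : sgraph) (S : {set G}) : {set G * G} :=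
  [set e in edges G | ((e.1 \in S) && (e.2 \notin S)) ||
                      ((e.2 \in S) && (e.1 \notin S))].

(* The minimum over an empty family (graphs with at most one vertex) is +oo. *)
Definition cheeger (R : realType) (G : sgraph) : \bar R :=
  \big[Order.min/+oo%E]_(S : {set G} | (S != finset.set0) && (2 * #|S| <= #|G|)%N)
    (#|edge_boundary S|%:R / #|S|%:R)%:E.

Definition poincare_ineq (R : realType) (G : sgraph) (M : metricType R)
    (p g : R) : Prop :=
  forall f : G -> M,
    (#|G|%:R ^+ 2)^-1 * (\sum_(v : G) \sum_(u : G) mdist (f v) (f u) `^ p)
    <= g / #|edges G|%:R * \sum_(e in edges G) mdist (f e.1) (f e.2) `^ p.

(* gamma G M p is the constant γ(G, ϱ^p) for ϱ = mdist on M; it is +oo when no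
   finite constant works.  The infimum is attained as soon as it is positive;
   it is 0, and not attained, when all maps from G to M are constant. *)
Definition gamma (R : realType) (G : sgraph) (M : metricType R) (p : R) :
    \bar R :=
  ereal_inf [set g%:E | g in [set g : R | 0 < g /\ poincare_ineq G M p g]].

(* Main.v *)
Require Import Defs.
From mathcomp Require Import all_boot all_order all_algebra.
From mathcomp Require Import all_classical all_reals all_analysis.
From mathcomp Require Import lra ring zify.

Set Implicit Arguments.
Unset Strict Implicit.
Unset Printing Implicit Defensive.

Import Order.TTheory GRing.Theory Num.Theory.

Local Open Scope ring_scope.

(* Let r be least such that some ball B(f x, r) contains at least half of the
   values of f.  Cheeger's inequality, applied to the powers of
   v |-> max(0, rho(f x, f v) - r), which vanishes on half of the vertices,
   bounds the tails of rho(f x, f v) by edge sums.  For both exponents this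
   reduces the Poincare inequality for f to a bound on r.  By minimality every
   f v is at distance at least r from half of the values.

   Upper exponent: the Poincare inequality for p bounds r^p by gamma_p times the
   p-average of f over edges, which Jensen compares with the q-average; the tail
   term is absorbed because gamma_p >= 1/4 as soon as M has two points.

   Lower exponent: collapsing to f x the few values at distance more than 2 r
   from f x gives a map g whose q-energy over edges is at most a multiple of
   r^(q-p) times the p-energy of f, while r^q is still a typical value of
   rho(g v, g u)^q; then divide the Poincare inequality for q by r^(q-p). *)

(** * Counting edge ends in a regular graph *)

(** Each vertex is an end of [d] edges. Later this charges the edges that meet a set to the vertices
    of that set. *)
Lemma sum_edges_ends (R : realType) (G : sgraph) (d : nat) (w : G -> R) :
  regular G d ->
  \sum_(e in edges G) (w e.1 + w e.2) = d%:R * \sum_(v : G) w v.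
Proof.
move=> regG; transitivity (\sum_(v : G) \sum_(u | adj v u) w v); last first.
  rewrite mulr_sumr; apply: eq_bigr => v _.
  by rewrite big_const iter_addr_0 -(regG v) cardsE mulr_natl.
under [RHS]eq_bigr => v _ do
  rewrite (bigID (fun u => enum_rank v < enum_rank u)%N) /=.
rewrite !big_split; congr (_ + _).
  by rewrite pair_big_dep; apply: eq_bigl => -[v u]; rewrite inE.
(* The pairs of decreasing rank are the swapped edges; equal ranks would give a loop. *)
rewrite pair_big_dep /=.
rewrite (reindex_inj (h := fun e : G * G => (e.2, e.1))) /=; last first.
  by move=> [v u] [v' u'] [-> ->].
apply: eq_bigl => -[v u]; rewrite inE /= (adj_sym u v).
have [adj_vu|//] := boolP (adj v u); rewrite /= -leqNgt [RHS]leq_eqVlt.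
case: eqVneq => [eq_uv|//].
by move: adj_vu; rewrite (enum_rank_inj (val_inj eq_uv)) adj_irrefl.
Qed.

Lemma card_edges (R : realType) (G : sgraph) (d : nat) :
  regular G d -> #|edges G|%:R * 2 = d%:R * #|G|%:R :> R.
Proof.
move=> regG; have := @sum_edges_ends R G d (fun=> 1) regG.
by rewrite !sumr_const -[(1 + 1) *+ _]mulr_natl.
Qed.

(** * Cheeger's inequality for functions and for their powers *)

(** Free of division, so that the empty set needs no exception. *)
Definition expands (R : realType) (G : sgraph) (h : R) : Prop :=
  forall S : {set G}, (2 * #|S| <= #|G|)%N ->
    h * #|S|%:R <= #|edge_boundary S|%:R.

Lemma cheeger_expands (R : realType) (G : sgraph) (h : R) :
  cheeger R G = h%:E -> expands G h.
Proof.
move=> chG S leS; have [->|S0] := eqVneq S finset.set0.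
  by rewrite cards0 mulr0.
have : (h%:E <= (#|edge_boundary S|%:R / #|S|%:R)%:E)%E.
  by rewrite -chG /cheeger; apply: bigmin_le_cond; rewrite S0.
by rewrite lee_fin ler_pdivlMr // ltr0n card_gt0.
Qed.

Lemma cheeger_card_gt1 (R : realType) (G : sgraph) (h : R) :
  cheeger R G = h%:E -> (1 < #|G|)%N.
Proof.
rewrite ltnNge => chG; apply/negP => leG1; move: chG.
rewrite /cheeger big_pred0 // => S.
by apply/negbTE; rewrite -card_gt0 negb_and -!ltnNge; lia.
Qed.

(* Subtracting from [w] its least positive value on its support [S] lowers the
   two sides by multiples of [h * #|S|] and of [#|edge_boundary S|]. *)
Lemma expands_sum_le (R : realType) (G : sgraph) (h : R) (w : G -> R) :
  expands G h -> (forall v, 0 <= w v) ->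
  (2 * #|[set v | (0 < w v)%R]| <= #|G|)%N ->
  h * \sum_v w v <= \sum_(e in edges G) `|w e.1 - w e.2|.
Proof.
(* The induction is on a bound for the size of the support, since subtracting the minimum may remove
   several vertices at once. *)
move=> expG; move: {2}#|_| (leqnn #|[set v | (0 < w v)%R]|) => k.
elim: k w => [|k IHk] w lek w0 le2.
  rewrite big1 ?mulr0 ?sumr_ge0 // => v _; apply/le_anti; rewrite w0 andbT.
  move: lek; rewrite leqn0 cards_eq0 => /eqP/setP/(_ v).
  by rewrite !inE leNgt => ->.
set S := [set v | (0 < w v)%R] in lek le2.
have [S0|[v0 Sv0]] := set_0Vmem S.
  by apply: IHk => //; rewrite -/S S0 cards0.
pose i0 := [arg min_(v < v0 in S) w v]%O.
have [Si0 mini0] : i0 \in S /\ forall v, v \in S -> w i0 <= w v.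
  by rewrite /i0; case: arg_minP.
have a0 : 0 < w i0 by move: Si0; rewrite inE.
pose w' v := w v - w i0 * (v \in S)%:R.
have w'E v : v \notin S -> w v = 0 /\ w' v = 0.
  move=> vS; suff w0v : w v = 0 by rewrite /w' w0v (negPf vS) mulr0 subr0.
  by apply/le_anti; rewrite w0 andbT leNgt; move: vS; rewrite inE.
have w'0 v : 0 <= w' v.
  have [vS|/w'E[_ ->]//] := boolP (v \in S).
  by rewrite /w' vS mulr1 subr_ge0 mini0.
have sub : [set v | 0 < w' v] \subset S :\ i0.
  apply/fintype.subsetP => v; rewrite !inE => w'v; apply/andP; split.
    by apply: contraTneq w'v => ->; rewrite /w' Si0 mulr1 subrr ltxx.
  apply: contraTT w'v => wv.
  by rewrite (w'E v _).2 ?ltxx // inE.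
have cardS : #|S| = #|S :\ i0|.+1 by rewrite (cardsD1 i0) Si0.
have le1 := subset_leq_card sub.
have IH : h * \sum_v w' v <= \sum_(e in edges G) `|w' e.1 - w' e.2|.
  by apply: IHk => //; lia.
have -> : \sum_v w v = \sum_v w' v + w i0 * #|S|%:R.
  have -> : #|S|%:R = \sum_v (v \in S)%:R :> R.
    by rewrite -sum1_card natr_sum big_mkcond; apply: eq_bigr => v _; case: ifP.
  rewrite mulr_sumr -big_split; apply: eq_bigr => v _.
  by rewrite /= /w' subrK.
(* Since [w] and [w'] vanish off [S], an edge crossing the boundary loses exactly [w i0] and every
   other edge keeps its difference. *)
have -> : \sum_(e in edges G) `|w e.1 - w e.2| =
    \sum_(e in edges G) `|w' e.1 - w' e.2| + w i0 * #|edge_boundary S|%:R.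
  have -> : #|edge_boundary S|%:R =
      \sum_(e in edges G) ((e.1 \in S) (+) (e.2 \in S))%:R :> R.
    rewrite -sum1_card natr_sum big_mkcond [RHS]big_mkcond.
    apply: eq_bigr => e _; rewrite inE; case: (e \in edges G) => //=.
    by case: (e.1 \in S); case: (e.2 \in S).
  rewrite mulr_sumr -big_split; apply: eq_bigr => -[v u] _ /=.
  have [vS|vS] := boolP (v \in S); have [uS|uS] := boolP (u \in S) => /=.
  - by rewrite mulr0 addr0 /w' vS uS opprB addrA subrK.
  - rewrite (w'E u uS).1 (w'E u uS).2 !subr0 !ger0_norm //.
    by rewrite /w' vS subrK.
  - rewrite (w'E v vS).1 (w'E v vS).2 !sub0r !normrN !ger0_norm //.
    by rewrite /w' uS subrK.
  - by rewrite mulr0 addr0 (w'E v vS).1 (w'E v vS).2 (w'E u uS).1 (w'E u uS).2.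
rewrite mulrDr lerD // mulrCA ler_wpM2l ?(ltW a0) //.
exact: expG.
Qed.

(** Let [b <= a]. If [b <= t * a], then [a - b] is at least [(1 - t) * a] and its power dominates
    [a^p]. Otherwise [a^p <= (1 + eta) * b^p], because [t^p = 1 / (1 + eta)]. This treats exponents
    below and above 1 alike. *)
Lemma powR_lipschitz_error (R : realType) (p eta : R) :
  0 < p -> 0 < eta -> exists2 c : R, 0 < c & forall a b : R, 0 <= a -> 0 <= b ->
    `|a `^ p - b `^ p| <= c * `|a - b| `^ p + eta * (a `^ p + b `^ p).
Proof.
move=> p0 eta0; pose t := (1 + eta)^-1 `^ p^-1.
have t0 : 0 < t by rewrite powR_gt0 // invr_gt0 addr_gt0.
have tp : t `^ p = (1 + eta)^-1.
  by rewrite -powRrM mulVf ?gt_eqF // powRr1 // invr_ge0 addr_ge0 // ltW.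
have t1 : t < 1.
  have -> : 1 = 1 `^ p^-1 :> R by rewrite powR1.
  apply: gt0_ltr_powR; rewrite ?invr_gt0 // ?nnegrE //.
    by rewrite invr_ge0 addr_ge0 // ltW.
  by rewrite invf_lt1 ?ltrDl // addr_gt0.
have s0 : 0 < 1 - t by rewrite subr_gt0.
exists ((1 - t) `^ p)^-1; first by rewrite invr_gt0 powR_gt0.
move=> a b; wlog leba : a b / b <= a.
  move=> H a0 b0; have [|/ltW] := leP b a; first by move=> /H; apply.
  by move=> /H /(_ b0 a0); rewrite distrC [`|b - a|]distrC (addrC (b `^ _)).
move=> a0 b0; have [ap bp] := (powR_ge0 a p, powR_ge0 b p).
have lep : b `^ p <= a `^ p by rewrite ge0_ler_powR ?nnegrE // ltW.
rewrite !ger0_norm ?subr_ge0 //.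
have [leab|/ltW ltab] := leP ((1 - t) * a) (a - b).
  have : (1 - t) `^ p * a `^ p <= (a - b) `^ p.
    rewrite -powRM // ?(ltW s0) //.
    rewrite ge0_ler_powR ?nnegrE ?subr_ge0 // ?(ltW p0) //.
    by rewrite mulr_ge0 // ltW.
  rewrite -ler_pdivlMl ?powR_gt0 // => le1.
  have : 0 <= eta * (a `^ p + b `^ p) by rewrite mulr_ge0 ?addr_ge0 // ltW.
  by lra.
have : t `^ p * a `^ p <= b `^ p.
  rewrite -powRM // ?(ltW t0) // ge0_ler_powR ?nnegrE // ?(ltW p0) //.
    by rewrite mulr_ge0 // ltW.
  by lra.
rewrite tp ler_pdivrMl ?addr_gt0 // => le1.
have : 0 <= ((1 - t) `^ p)^-1 * (a - b) `^ p.
  by rewrite mulr_ge0 ?invr_ge0 ?powR_ge0.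
have : 0 <= eta * a `^ p by rewrite mulr_ge0 // ltW.
by lra.
Qed.

(** The inequality for sums is applied to the powers of [w]; the error terms add up to at most half
    of the left side and are absorbed. *)
Lemma expands_sum_powR_le (R : realType) (d : nat) (h p : R) :
  0 < h -> 0 < p -> exists2 K : R, 0 < K &
    forall (G : sgraph) (w : G -> R), regular G d -> expands G h ->
      (forall v, 0 <= w v) -> (2 * #|[set v | (0 < w v)%R]| <= #|G|)%N ->
      \sum_v w v `^ p <= K * \sum_(e in edges G) `|w e.1 - w e.2| `^ p.
Proof.
(* Chosen so that [eta * d <= h / 2]; the successor avoids dividing by zero when [d = 0]. *)
move=> h0 p0; pose eta := h / (2 * d.+1%:R).
have eta0 : 0 < eta by rewrite divr_gt0 // mulr_gt0.
have [c c0 lec] := powR_lipschitz_error p0 eta0.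
exists (2 * c / h); first by rewrite divr_gt0 // mulr_gt0.
move=> G w regG expG w0 le2.
set D := \sum_(e in edges G) _; set W := \sum_v _.
have W0 : 0 <= W by apply: sumr_ge0 => v _; exact: powR_ge0.
have : h * W <= \sum_(e in edges G) `|w e.1 `^ p - w e.2 `^ p|.
  apply: expands_sum_le => // [v|]; first exact: powR_ge0.
  apply: leq_trans le2; rewrite leq_mul2l subset_leq_card //.
  apply/fintype.subsetP => v; rewrite !inE.
  apply: contraTT; rewrite -leNgt => wv.
  have -> : w v = 0 by apply/le_anti; rewrite w0 wv.
  by rewrite powR0 ?ltxx // gt_eqF.
have : \sum_(e in edges G) `|w e.1 `^ p - w e.2 `^ p| <=
    c * D + eta * (d%:R * W).
  rewrite -(sum_edges_ends _ regG) !mulr_sumr -big_split /=.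
  by apply: ler_sum => e _; exact: lec.
have : eta * (d%:R * W) <= h / 2 * W.
  rewrite mulrA ler_wpM2r // /eta invfM mulrA -mulrA ler_piMr //.
    by rewrite divr_ge0 // ltW.
  by rewrite mulrC ler_pdivrMr // mul1r ler_nat.
move=> H1 H2 H3; rewrite mulrAC ler_pdivlMr // mulrC; lra.
Qed.

(** * Energies over pairs and edges, trading of exponents, and the median radius *)

Definition pair_sum (R : realType) (G : sgraph) (M : metricType R)
    (f : G -> M) (p : R) : R :=
  \sum_(v : G) \sum_(u : G) mdist (f v) (f u) `^ p.

Definition edge_sum (R : realType) (G : sgraph) (M : metricType R)
    (f : G -> M) (p : R) : R :=
  \sum_(e in edges G) mdist (f e.1) (f e.2) `^ p.

Lemma edge_sum_ge0 (R : realType) (G : sgraph) (M : metricType R)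
  (f : G -> M) (p : R) : 0 <= edge_sum f p.
Proof. by apply: sumr_ge0 => e _; exact: powR_ge0. Qed.

(** Clears denominators by means of [#|edges G| = d * #|G| / 2], which leaves inequalities fit for
    linear arithmetic. *)
Lemma poincare_ineqE (R : realType) (G : sgraph) (M : metricType R) (d : nat)
    (p g : R) :
  regular G d -> (0 < d)%N -> (0 < #|G|)%N ->
  poincare_ineq G M p g <->
  forall f : G -> M,
    d%:R * pair_sum f p <= 2 * #|G|%:R * g * edge_sum f p.
Proof.
move=> regG d0 n0.
have n0R : 0 < #|G|%:R :> R by rewrite ltr0n.
have d0R : 0 < d%:R :> R by rewrite ltr0n.
have E : #|edges G|%:R = d%:R * #|G|%:R / 2 :> R.
  by rewrite -(card_edges R regG) mulfK.
suff eq (f : G -> M) : (#|G|%:R ^+ 2)^-1 * pair_sum f p <=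
      g / #|edges G|%:R * edge_sum f p =
    (d%:R * pair_sum f p <= 2 * #|G|%:R * g * edge_sum f p).
  by split=> H f; [rewrite -eq; exact: H | move: (H f); rewrite -eq].
have c0 : 0 < d%:R * #|G|%:R ^+ 2 :> R by rewrite mulr_gt0 ?exprn_gt0.
rewrite -(ler_pM2l c0) E; congr (_ <= _).
  by field; rewrite gt_eqF.
by field; rewrite !gt_eqF.
Qed.

Lemma powR_split (R : realType) (p q x : R) :
  0 < q -> x `^ q = x `^ (q - p) * x `^ p.
Proof. by move=> q0; rewrite -powRD ?subrK // gt_eqF. Qed.

Lemma powR_le_trade (R : realType) (p q x y : R) :
  0 < p -> p <= q -> 0 <= x <= y -> x `^ q <= y `^ (q - p) * x `^ p.
Proof.
move=> p0 pq /andP[x0 xy].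
rewrite (powR_split p x (lt_le_trans p0 pq)) ler_wpM2r ?powR_ge0 //.
rewrite ge0_ler_powR ?nnegrE ?subr_ge0 //.
exact: le_trans xy.
Qed.

(** The left side is at most the [q]-th power of the larger of [t] and [x]. This crude form of
    Young's inequality does the work of Jensen's. *)
Lemma powR_mul_le_add (R : realType) (p q x t : R) :
  0 < p -> p <= q -> 0 <= x -> 0 <= t ->
  t `^ (q - p) * x `^ p <= t `^ q + x `^ q.
Proof.
move=> p0 pq x0 t0.
have split_q y := powR_split p y (lt_le_trans p0 pq).
have [xt|/ltW tx] := leP x t.
  rewrite (le_trans _ (_ : t `^ q <= _)) ?lerDl ?powR_ge0 // split_q.
  by rewrite ler_wpM2l ?powR_ge0 // ge0_ler_powR ?nnegrE // ltW.
rewrite (le_trans _ (_ : x `^ q <= _)) ?lerDr ?powR_ge0 // split_q.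
by rewrite ler_wpM2r ?powR_ge0 // ge0_ler_powR ?nnegrE ?subr_ge0.
Qed.

(* Take [r] least such that some ball of radius [r] around a value of [f]
   contains at least half of the values. *)
Lemma median_radius (R : realType) (G : sgraph) (M : metricType R)
    (f : G -> M) :
  (0 < #|G|)%N -> exists (x : G) (r : R),
    [/\ 0 <= r, (#|G| <= 2 * #|[set u | (mdist (f x) (f u) <= r)%R]|)%N &
        forall v, (#|G| <= 2 * #|[set u | (r <= mdist (f v) (f u))%R]|)%N].
Proof.
move=> /card_gt0P[v0 _].
pose dst (e : G * G) := mdist (f e.1) (f e.2).
pose P (e : G * G) :=
  (#|G| <= 2 * #|[set u | (mdist (f e.1) (f u) <= dst e)%R]|)%N.
have [u0 maxu0] : exists u0, forall u,
    mdist (f v0) (f u) <= mdist (f v0) (f u0).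
  exists [arg max_(u > v0) mdist (f v0) (f u)]%O.
  by case: arg_maxP => // u _ le u'; exact: le.
(* Only the finitely many distances between values are tried as radii; the ball around [f v0] that
   reaches its farthest value contains everything. *)
have P0 : P (v0, u0).
  rewrite /P /dst (_ : [set u | _] = [set: G]%SET); last first.
    by apply/setP => u; rewrite !inE maxu0.
  by rewrite cardsT leq_pmull.
have [e Pe mine] : exists2 e, P e & forall e', P e' -> dst e <= dst e'.
  by exists [arg min_(e < (v0, u0) | P e) dst e]%O; case: arg_minP.
exists e.1, (dst e); split=> // [|v]; first exact: mdist_ge0.
(* Otherwise more than half of the values lie at distance less than [dst e] from [f v], and the
   farthest of these gives a smaller admissible radius. *)
rewrite leqNgt; apply/negP => lt2.
pose S := [set u | mdist (f v) (f u) < dst e].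
have SC : (#|S| + #|[set u | (dst e <= mdist (f v) (f u))%R]| = #|G|)%N.
  rewrite -(cardsC S); congr (_ + _)%N; apply: eq_card => u.
  by rewrite !inE -leNgt.
have S0 : (0 < #|S|)%N.
  by move: SC lt2; move: #|S| #|[set u | _]| #|G| => a b c; lia.
have [u1 Su1] := card_gt0P S0.
pose u2 := [arg max_(u > u1 in S) mdist (f v) (f u)]%O.
have [Su2 maxu2] : u2 \in S /\
    forall u, u \in S -> mdist (f v) (f u) <= mdist (f v) (f u2).
  by rewrite /u2; case: arg_maxP.
have : dst e <= dst (v, u2).
  apply: mine; rewrite /P.
  have : (#|S| <= #|[set u | (mdist (f v) (f u) <= dst (v, u2))%R]|)%N.
    by apply/subset_leq_card/fintype.subsetP => u Su; rewrite inE maxu2.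
  move: SC lt2; move: #|S| #|[set u | _]| #|[set u | _]| #|G| => a b c n /=.
  by lia.
by rewrite leNgt; move: Su2; rewrite inE => ->.
Qed.

(** The truncated distance is 1-Lipschitz in the value [f v], so its differences along edges are at
    most those of [f]. *)
Lemma dist_tail_le (R : realType) (d : nat) (h p : R) :
  0 < h -> 0 < p -> exists2 K : R, 0 < K &
    forall (G : sgraph) (M : metricType R) (f : G -> M) (x : M) (r : R),
      regular G d -> expands G h ->
      (#|G| <= 2 * #|[set v | (mdist x (f v) <= r)%R]|)%N ->
      \sum_v Num.max 0 (mdist x (f v) - r) `^ p <= K * edge_sum f p.
Proof.
move=> h0 p0; have [K K0 HK] := expands_sum_powR_le d h0 p0.
exists K => // G M f x r regG expG half.
apply: le_trans (HK G (fun v => Num.max 0 (mdist x (f v) - r)) regG expG _ _) _.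
- by move=> v; rewrite le_max lexx.
- move: half; have := cardsC [set v | mdist x (f v) <= r].
  rewrite (_ : ~: [set v | mdist x (f v) <= r] =
    [set v | 0 < Num.max 0 (mdist x (f v) - r)]).
    by move: #|[set v | _]| #|[set v | _]| #|G| => a b n; lia.
  by apply/setP => v; rewrite !inE lt_max ltxx subr_gt0 -ltNge.
rewrite ler_pM2l //; apply: ler_sum => -[v u] _ /=.
rewrite ge0_ler_powR ?nnegrE ?mdist_ge0 ?normr_ge0 ?(ltW p0) //.
have := metric_triangle x (f v) (f u); have := metric_triangle x (f u) (f v).
rewrite (metric_sym (f u)) => le1 le2.
have := mdist_ge0 (f v) (f u) => le0.
by rewrite /Num.max; case: ltP => ?; case: ltP => ?; rewrite ler_norml; lra.
Qed.

(** By the triangle inequality through [x], a distance is at most 4 times the largest of [r],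
    [psi v] and [psi u], and the power of a maximum is at most the sum of the powers. No convexity
    is involved, so any [p > 0] will do. *)
Lemma pair_sum_le (R : realType) (G : sgraph) (M : metricType R)
    (f : G -> M) (x : M) (r p : R) :
  0 < p -> 0 <= r ->
  pair_sum f p <= 4 `^ p * (#|G|%:R ^+ 2 * r `^ p +
    2 * #|G|%:R * \sum_v Num.max 0 (mdist x (f v) - r) `^ p).
Proof.
move=> p0 r0; pose psi v := Num.max 0 (mdist x (f v) - r).
have psi0 v : 0 <= psi v by rewrite le_max lexx.
have dist_le v : mdist x (f v) <= r + psi v.
  by rewrite /psi -lerBlDl le_max lexx orbT.
rewrite -/(psi _) (_ : 4 `^ p * _ =
    \sum_(v : G) \sum_(u : G) 4 `^ p * (r `^ p + psi v `^ p + psi u `^ p)).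
  apply: ler_sum => v _; apply: ler_sum => u _.
  have dist_max : mdist (f v) (f u) <= 4 * Num.max r (Num.max (psi v) (psi u)).
    have := metric_triangle (f v) x (f u); rewrite (metric_sym (f v) x).
    have := dist_le v; have := dist_le u.
    set m := Num.max r _ => le1 le2 le3.
    have m1 : r <= m by rewrite le_max lexx.
    have m2 : psi v <= m by rewrite 2!le_max lexx orbT.
    have m3 : psi u <= m by rewrite 2!le_max lexx !orbT.
    lra.
  apply: le_trans (_ : (4 * Num.max r (Num.max (psi v) (psi u))) `^ p <= _).
    rewrite ge0_ler_powR ?nnegrE ?mdist_ge0 ?(ltW p0) //.
    by rewrite mulr_ge0 // le_max r0.
  rewrite powRM // ?le_max ?r0 // ler_wpM2l ?powR_ge0 //.
  have := powR_ge0 r p; have := powR_ge0 (psi v) p; have := powR_ge0 (psi u) p.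
  rewrite {1}/Num.max; case: ltP => _; last by lra.
  by rewrite {1}/Num.max; case: ltP => _; lra.
under [RHS]eq_bigr => v _ do rewrite -mulr_sumr !big_split /= !sumr_const.
rewrite -mulr_sumr !big_split /= !sumr_const sumrMnl; congr (_ * _).
by ring.
Qed.

(** Markov's inequality for each [v]. The median radius gives [k = 2]; after some vertices are moved
    [k = 4] is left. *)
Lemma pair_sum_ge (R : realType) (G : sgraph) (M : metricType R)
    (f : G -> M) (r p : R) (k : nat) :
  0 < p -> 0 <= r ->
  (forall v, (#|G| <= k * #|[set u | (r <= mdist (f v) (f u))%R]|)%N) ->
  #|G|%:R ^+ 2 * r `^ p <= k%:R * pair_sum f p.
Proof.
move=> p0 r0 far; rewrite expr2 -mulrA.
have -> : #|G|%:R * (#|G|%:R * r `^ p) = \sum_(v : G) #|G|%:R * r `^ p.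
  by rewrite sumr_const mulr_natl.
rewrite /pair_sum mulr_sumr; apply: ler_sum => v _.
set S := [set u | r <= mdist (f v) (f u)].
apply: le_trans (_ : (k * #|S|)%:R * r `^ p <= _).
  by rewrite ler_wpM2r ?powR_ge0 // ler_nat far.
rewrite natrM -mulrA ler_wpM2l // [leRHS](bigID (mem S)) /=.
rewrite -[leLHS]addr0 lerD ?sumr_ge0 // => [|u _]; last exact: powR_ge0.
rewrite mulr_natl -sumr_const; apply: ler_sum => u; rewrite inE => ru.
by rewrite ge0_ler_powR ?nnegrE ?mdist_ge0 // ltW.
Qed.

(** * From the exponent [q] down to [p] *)

Ltac nonneg := repeat first
  [ assumption | by apply: ltW | exact: powR_ge0 | exact: ler0n
  | apply: mulr_ge0 | apply: addr_ge0 ].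

Lemma poincare_ineq_lower (R : realType) (d : nat) (h p q : R) :
  (0 < d)%N -> 0 < h -> 0 < p -> p <= q -> exists2 C : R, 0 < C &
    forall (G : sgraph) (M : metricType R) (g : R),
      regular G d -> expands G h -> (0 < #|G|)%N -> 0 < g ->
      poincare_ineq G M q g -> poincare_ineq G M p (C * Num.max 1 g).
Proof.
move=> d0 h0 p0 pq; have q0 : 0 < q := lt_le_trans p0 pq.
have d0R : 0 < d%:R :> R by rewrite ltr0n.
have [K K0 tail] := dist_tail_le d h0 p0.
(* The first term comes from the edges that avoid the moved vertices, the second from those that
   meet them. *)
pose B : R := 4 `^ (q - p) + d%:R * 4 `^ q * K.
have B0 : 0 < B by rewrite addr_gt0 ?mulr_gt0 ?powR_gt0.
exists (4 `^ p * (4 * B + 3 * (d%:R * K))).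
  by rewrite mulr_gt0 ?powR_gt0 // addr_gt0 ?mulr_gt0.
move=> G M g regG expG n0 g0 /(poincare_ineqE _ _ _ regG d0 n0) Pq.
apply/(poincare_ineqE _ _ _ regG d0 n0) => f.
have [x [r [r0 near far]]] := median_radius f n0.
set n := #|G|%:R : R; have n0R : 0 < n by rewrite ltr0n.
set m := Num.max 1 g; have m1 : 1 <= m by rewrite le_max lexx.
have m0 : 0 <= m by exact: le_trans m1.
have gm : g <= m by rewrite le_max lexx orbT.
set E := edge_sum f p; have E0 : 0 <= E := edge_sum_ge0 f p.
have {}tail := tail G M f (f x) r regG expG near; rewrite -/E in tail.
have {near} Dle := pair_sum_le f (f x) p0 r0.
rewrite -/n in Dle.
set psi := fun v => Num.max 0 (mdist (f x) (f v) - r) in tail Dle.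
suff rE : d%:R * n * r `^ p <= (8 * B + 4 * (d%:R * K)) * m * E.
  have dKE : d%:R * K * E <= d%:R * K * m * E.
    by rewrite ler_wpM2r // ler_peMr //; nonneg.
  have le1 : d%:R * (n ^+ 2 * r `^ p + 2 * n * \sum_v psi v `^ p) <=
      n * ((8 * B + 4 * (d%:R * K)) * m * E) + 2 * n * (d%:R * K * m * E).
    have := ler_wpM2l (ltW n0R) rE.
    have := ler_wpM2l (ltW (mulr_gt0 d0R n0R)) tail.
    have := ler_wpM2l (ltW n0R) dKE.
    by lra.
  have := ler_wpM2l (ltW d0R) Dle.
  have := ler_wpM2l (powR_ge0 4 p) le1.
  by lra.
(* A zero radius is set aside because [r^(q - p)] is divided out at the end. *)
move: r0; rewrite le_eqVlt => /predU1P[<-|r0].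
  by rewrite powR0 ?gt_eqF // mulr0; nonneg.
(* By the tail bound [W] is small, and moving its vertices to [x] turns [f] into
   a map of diameter at most [4 * r], on which exponents can be traded. *)
pose W := [set v | 2 * r < mdist (f x) (f v)].
have WE : #|W|%:R * r `^ p <= K * E.
  apply: le_trans tail; rewrite (bigID (mem W)) /= -[leLHS]addr0.
  rewrite lerD ?sumr_ge0 // => [|v _]; last exact: powR_ge0.
  rewrite mulr_natl -sumr_const; apply: ler_sum => v; rewrite inE => vW.
  have vr : r <= psi v by rewrite /psi le_max lerBrDr; apply/orP; right; lra.
  rewrite ge0_ler_powR ?nnegrE // ?(ltW p0) ?(ltW r0) //.
  by rewrite (le_trans _ vr) // ltW.
(* If [W] has more than a quarter of the vertices, the tail bound alone controls [r]. *)
have [ltW4|le4W] := ltnP #|G| (4 * #|W|).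
  have nW : n <= 4 * #|W|%:R by rewrite -natrM ler_nat ltnW.
  have le1 : d%:R * n * r `^ p <= 4 * (d%:R * K) * E.
    have := ler_wpM2l (ltW d0R) (ler_wpM2r (powR_ge0 r p) nW).
    have := ler_wpM2l (ltW d0R) WE.
    by lra.
  apply: le_trans le1 _; rewrite ler_wpM2r // -[leLHS]mulr1 ler_pM //.
    by nonneg.
  by rewrite lerDr; nonneg.
pose y v := if v \in W then x else v.
have yr v : mdist (f x) (f (y v)) <= 2 * r.
  rewrite /y; case: ifPn => [_|]; last by rewrite inE -leNgt.
  by rewrite mdistxx mulr_ge0 // ltW.
(* At least half of the values of [f] are at distance at least [r] from [f (y v)], and at most a
   quarter of the vertices were moved, so a quarter still qualifies. *)
have Elow : n ^+ 2 * r `^ q <= 4 * pair_sum (f \o y) q.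
  apply: (pair_sum_ge (k := 4)) => // [|v]; first exact: ltW.
  have arith (a b c k : nat) :
    (4 * c <= k -> k <= 2 * a -> a <= b + c -> k <= 4 * b)%N by clear; lia.
  apply: arith le4W (far (y v)) _.
  rewrite -cardsUI; apply: leq_trans (leq_addr _ _).
  apply/subset_leq_card/fintype.subsetP => u; rewrite !inE /= => ru.
  have [uW|uW] := boolP (u \in W).
    by move: uW; rewrite inE => ->; rewrite orbT.
  by rewrite {2}/y (negPf uW) ru.
(* Every edge now has length at most [4 * r]. Those meeting [W] number at most [d * #|W|], which
   [WE] bounds; the others kept their length, and exponents are traded on them. *)
have Eup : edge_sum (f \o y) q <= r `^ (q - p) * (B * E).
  have ry v u : mdist (f (y v)) (f (y u)) <= 4 * r.
    have := metric_triangle (f (y v)) (f x) (f (y u)).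
    by rewrite (metric_sym _ (f x)); have := yr v; have := yr u; lra.
  have r40 : 0 <= 4 * r by rewrite mulr_ge0 // ltW.
  pose w v : R := (v \in W)%:R.
  have : edge_sum (f \o y) q <=
      (4 * r) `^ (q - p) * E + (4 * r) `^ q * (d%:R * #|W|%:R).
    have -> : #|W|%:R = \sum_v w v.
      rewrite -sum1_card natr_sum big_mkcond; apply: eq_bigr => v _.
      by rewrite /w; case: ifP.
    rewrite -(sum_edges_ends _ regG) !mulr_sumr -big_split /=.
    apply: ler_sum => -[v u] _ /=.
    have moved : mdist (f (y v)) (f (y u)) `^ q <= (4 * r) `^ q.
      by rewrite ge0_ler_powR ?nnegrE ?mdist_ge0 ?(ltW q0).
    have nn1 : 0 <= (4 * r) `^ (q - p) * mdist (f v) (f u) `^ p.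
      by rewrite mulr_ge0 ?powR_ge0.
    have nn2 := powR_ge0 (4 * r) q.
    rewrite /w; have [vW|vW] := boolP (v \in W).
      by case: (u \in W); rewrite /=; lra.
    have [uW|uW] := boolP (u \in W); first by rewrite /=; lra.
    rewrite addr0 mulr0 addr0; have := ry v u.
    rewrite /y (negPf vW) (negPf uW) => le_r.
    by apply: powR_le_trade; rewrite // mdist_ge0.
  move=> le1; apply: le_trans le1 _.
  rewrite !powRM ?(ltW r0) // (powR_split p r q0).
  have : 0 <= d%:R * 4 `^ q * r `^ (q - p) :> R.
    by nonneg.
  by move=> /ler_wpM2l/(_ _ _ WE); rewrite /B; lra.
have rqp := powR_gt0 (q - p) r0.
have : d%:R * n * r `^ p <= 8 * B * g * E.
  rewrite -(ler_pM2l (mulr_gt0 n0R rqp)).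
  have := Pq (f \o y); rewrite -/n => le1.
  have ng : 0 <= 2 * n * g by nonneg.
  have := ler_wpM2l ng Eup.
  have := ler_wpM2l (ltW d0R) Elow; rewrite (powR_split p r q0).
  by lra.
move=> le1; apply: le_trans le1 _; rewrite ler_wpM2r //.
apply: le_trans (_ : 8 * B * m <= _).
  by rewrite ler_wpM2l //; nonneg.
by rewrite ler_wpM2r // lerDl; nonneg.
Qed.

(** * From the exponent [p] up to [q] *)

(** The test map sends one vertex to [a] and all others to [b]: only the [d] edges at that vertex
    have positive length. *)
Lemma poincare_ineq_ge (R : realType) (G : sgraph) (M : metricType R) (d : nat)
    (p g : R) (a b : M) :
  regular G d -> (0 < d)%N -> (1 < #|G|)%N -> 0 < p -> a != b ->
  poincare_ineq G M p g -> 1 <= 4 * g.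
Proof.
move=> regG d0 n1 p0 neq_ab.
have n0 : (0 < #|G|)%N by exact: ltnW.
move/(poincare_ineqE _ _ _ regG d0 n0) => Pp.
have [v0 _] := card_gt0P n0.
pose f (v : G) := if v == v0 then a else b.
have s0 : 0 < mdist a b `^ p by rewrite powR_gt0 // mdist_gt0.
set s := _ `^ p in s0.
have d0R : 0 < d%:R :> R by rewrite ltr0n.
have n0R : 0 < #|G|%:R :> R by rewrite ltr0n.
have zero c : mdist c c `^ p = 0 :> R by rewrite mdistxx powR0 // gt_eqF.
have Eup : edge_sum f p <= s * d%:R.
  have -> : d%:R = d%:R * \sum_v (v == v0)%:R :> R.
    rewrite (bigD1 v0) //= eqxx big1 ?addr0 ?mulr1 // => v /negPf ->.
    by [].
  rewrite -(sum_edges_ends _ regG) mulr_sumr; apply: ler_sum => -[v u] _ /=.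
  rewrite /f; case: (v == v0); case: (u == v0) => /=.
  - by rewrite zero mulr_ge0 // ltW.
  - by rewrite addr0 mulr1.
  - by rewrite metric_sym add0r mulr1.
  - by rewrite zero addr0 mulr0.
(* The pairs starting at [v0] already give [#|G| - 1] terms [s], at least half of [#|G|] since there
   are two vertices. *)
have Dlow : #|G|%:R * s <= 2 * pair_sum f p.
  have -> : pair_sum f p = \sum_(u | u != v0) s +
      \sum_(v | v != v0) \sum_u mdist (f v) (f u) `^ p.
    rewrite /pair_sum (bigD1 v0) //=; congr (_ + _).
    rewrite (bigD1 v0) //= zero add0r; apply: eq_bigr => u /negPf uv.
    by rewrite /f eqxx uv.
  have : 0 <= \sum_(v | v != v0) \sum_u mdist (f v) (f u) `^ p.
    by apply: sumr_ge0 => v _; apply: sumr_ge0 => u _; exact: powR_ge0.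
  have -> : \sum_(u | u != v0) s = #|G|%:R * s - s.
    by rewrite mulr_natl -sumr_const [in RHS](bigD1 v0) //= [s + _]addrC addrK.
  have : 2 * s <= #|G|%:R * s by rewrite ler_pM2r // ler_nat.
  by lra.
have := Pp f => le1.
have dns : 0 < #|G|%:R * d%:R * s by rewrite !mulr_gt0.
have := ler_wpM2l (ltW d0R) Dlow.
have [gneg|g0] := ltP g 0.
  have : #|G|%:R * g * edge_sum f p <= 0.
    by rewrite mulr_le0_ge0 ?edge_sum_ge0 // mulr_ge0_le0 // ltW.
  by nra.
have ng : 0 <= 2 * #|G|%:R * g by nonneg.
move=> le3; have le4 := ler_wpM2l ng Eup.
rewrite -(ler_pM2l dns); lra.
Qed.

Lemma poincare_ineq_upper (R : realType) (d : nat) (h p q : R) :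
  (0 < d)%N -> 0 < h -> 0 < p -> p <= q -> exists2 C : R, 0 < C &
    forall (G : sgraph) (M : metricType R) (g : R),
      regular G d -> expands G h -> (1 < #|G|)%N -> 0 < g ->
      poincare_ineq G M p g -> poincare_ineq G M q (C * g `^ (q / p)).
Proof.
move=> d0 h0 p0 pq; have q0 : 0 < q := lt_le_trans p0 pq.
have d0R : 0 < d%:R :> R by rewrite ltr0n.
have [K K0 tail] := dist_tail_le d h0 q0.
exists (4 `^ q * 4 `^ (q / p) * (1 + d%:R * K)).
  by rewrite mulr_gt0 ?mulr_gt0 ?powR_gt0 // addr_gt0 ?mulr_gt0.
move=> G M g regG expG n1 g0 Pp; have n0 : (0 < #|G|)%N by exact: ltnW.
apply/(poincare_ineqE _ _ _ regG d0 n0) => f.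
have E0 : 0 <= edge_sum f q := edge_sum_ge0 f q.
(* A nonconstant map supplies the two points needed for the lower bound on [g]. *)
have [/forallP cst|/forallPn[v0 /forallPn[u0 neq]]] :=
    boolP [forall v, forall u, f v == f u].
  rewrite /pair_sum big1 ?mulr0 => [|v _].
    by nonneg.
  rewrite big1 // => u _; move/forallP: (cst v) => /(_ u)/eqP ->.
  by rewrite mdistxx powR0 // gt_eqF.
have g4 := poincare_ineq_ge regG d0 n1 p0 neq Pp.
move: Pp => /(poincare_ineqE _ _ _ regG d0 n0) Pp.
have [x [r [r0 near far]]] := median_radius f n0.
set n := #|G|%:R : R; have n0R : 0 < n by rewrite ltr0n.
have {}tail := tail G M f (f x) r regG expG near.
have {near} Dle := pair_sum_le f (f x) q0 r0.
rewrite -/n in Dle.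
set psi := fun v => Num.max 0 (mdist (f x) (f v) - r) in tail Dle.
set E := edge_sum f q in E0 tail *.
have g40 : 0 < 4 * g by rewrite mulr_gt0.
set c := (4 * g) `^ (q / p).
have c1 : 1 <= c.
  have qp : 0 <= q / p by rewrite divr_ge0 // ltW.
  by have := ler_powR g4 qp; rewrite powRr0.
suff rE : d%:R * n * r `^ q <= 2 * c * E.
  have dKE : d%:R * K * E <= d%:R * K * c * E.
    by rewrite ler_wpM2r // ler_peMr //; nonneg.
  have le1 : d%:R * (n ^+ 2 * r `^ q + 2 * n * \sum_v psi v `^ q) <=
      n * (2 * c * E) + 2 * n * (d%:R * K * c * E).
    have := ler_wpM2l (ltW n0R) rE.
    have := ler_wpM2l (ltW (mulr_gt0 d0R n0R)) tail.
    have := ler_wpM2l (ltW n0R) dKE.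
    by lra.
  have := ler_wpM2l (ltW d0R) Dle.
  have := ler_wpM2l (powR_ge0 4 q) le1.
  rewrite /c powRM // ?(ltW g0) //.
  by lra.
(* In the scale of [t] the inequality for [p] has no constant: [t^p] is at most half of the average
   of the [p]-th powers over the [d * n / 2] edges. *)
pose t := r / (4 * g) `^ p^-1.
have t0 : 0 <= t by rewrite divr_ge0 ?powR_ge0.
have rt : r = t * (4 * g) `^ p^-1 by rewrite /t divfK // gt_eqF // powR_gt0.
have rp : r `^ p = 4 * g * t `^ p.
  rewrite rt powRM ?powR_ge0 // -powRrM mulVf ?gt_eqF // powRr1 ?(ltW g40) //.
  by rewrite mulrC.
have rq : r `^ q = c * t `^ q.
  by rewrite rt powRM ?powR_ge0 // -powRrM (mulrC p^-1) [LHS]mulrC.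
have Elow : d%:R * n * t `^ p <= edge_sum f p.
  have := pair_sum_ge p0 r0 far; rewrite -/n => le1.
  have := Pp f; rewrite -/n => le2.
  rewrite -(ler_pM2l (mulr_gt0 n0R g40)).
  have := ler_wpM2l (ltW d0R) le1; rewrite rp; lra.
(* Summed over the edges, the terms [t^q] make up only half of [d * n * t^q], so they can be
   absorbed. *)
have Eup : t `^ (q - p) * edge_sum f p <= d%:R * n / 2 * t `^ q + E.
  have <- : #|edges G|%:R = d%:R * n / 2 :> R.
    by rewrite -(card_edges R regG) mulfK.
  rewrite /E /edge_sum mulr_sumr mulr_natl -sumr_const -big_split /=.
  by apply: ler_sum => e _; apply: powR_mul_le_add => //; exact: mdist_ge0.
have le3 := ler_wpM2l (powR_ge0 t (q - p)) Elow.
have : d%:R * n * t `^ q <= 2 * E.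
  by move: Eup le3; rewrite (powR_split p t q0); lra.
by move=> /(ler_wpM2l (le_trans ler01 c1)); rewrite rq; lra.
Qed.

(** * From admissible constants to their infimum *)

Lemma gamma_le (R : realType) (G : sgraph) (M : metricType R) (p g : R) :
  0 < g -> poincare_ineq G M p g -> (gamma G M p <= g%:E)%E.
Proof. by move=> g0 Pg; apply: ereal_inf_lbound; exists g. Qed.

Lemma gamma_ge0 (R : realType) (G : sgraph) (M : metricType R) (p : R) :
  (0 <= gamma G M p)%E.
Proof. by apply/ereal_infP => _ [g [g0 _] <-]; rewrite lee_fin ltW. Qed.

Lemma gamma_lt (R : realType) (G : sgraph) (M : metricType R) (p x : R) :
  (gamma G M p < x%:E)%E -> exists g, [/\ 0 < g, poincare_ineq G M p g & g < x].
Proof.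
move=> ltx; apply: contrapT => no_g; move: ltx; apply/negP; rewrite -leNgt.
apply/ereal_infP => _ [g [g0 Pg] <-]; rewrite lee_fin leNgt.
by apply/negP => gx; apply: no_g; exists g.
Qed.

(** The infimum may not be attained, so an admissible [g] within [e / C] of it is used; the factor
    [C] turns this slack into [e]. *)
Lemma gamma_lower (R : realType) (G : sgraph) (M : metricType R) (p q C : R) :
  0 < C ->
  (forall g, 0 < g -> poincare_ineq G M q g ->
    poincare_ineq G M p (C * Num.max 1 g)) ->
  (gamma G M p <= C%:E * Order.max 1 (gamma G M q))%E.
Proof.
move=> C0 H; have := gamma_ge0 G M q.
case Eq : (gamma G M q) => [a| |] // a0; last first.
  by rewrite (max_idPr _) ?leey // gt0_muley ?leey ?lte_fin.
rewrite -EFin_max -EFinM; apply/lee_addgt0Pr => e e0.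
have eC : 0 < e / C by rewrite divr_gt0.
have [|g [g0 Pg ga]] := @gamma_lt _ G M q (a + e / C).
  by rewrite Eq lte_fin ltrDl.
have max_gt0 : 0 < C * Num.max 1 g by rewrite mulr_gt0 // lt_max ltr01.
apply: le_trans (gamma_le max_gt0 (H g g0 Pg)) _.
have eE : e = C * (e / C) by rewrite mulrCA divff ?mulr1 ?gt_eqF.
rewrite -EFinD lee_fin [e in leRHS]eE -mulrDr.
rewrite ler_pM2l // ge_max; apply/andP; split.
  by rewrite -[leLHS]addr0 lerD ?le_max ?lexx // ltW.
by apply: le_trans (ltW ga) _; rewrite lerD2r le_max lexx orbT.
Qed.

(** Inverting the power replaces a continuity argument: if the bound failed, [(T / C)^(p / q)] would
    exceed the infimum for [p], and an admissible [g'] below it would push the infimum for [q] under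
    its value [T]. *)
Lemma gamma_upper (R : realType) (G : sgraph) (M : metricType R) (p q C : R) :
  0 < C -> 0 < p -> 0 < q ->
  (forall g, 0 < g -> poincare_ineq G M p g ->
    poincare_ineq G M q (C * g `^ (q / p))) ->
  (gamma G M q <= C%:E * gamma G M p `^ (q / p))%E.
Proof.
move=> C0 p0 q0 H; have qp0 : 0 < q / p by rewrite divr_gt0.
have gamma_q_le x : (gamma G M p < x%:E)%E ->
    exists2 g, 0 < g < x & (gamma G M q <= (C * g `^ (q / p))%:E)%E.
  move=> /gamma_lt[g [g0 Pg gx]]; exists g; first by rewrite g0.
  by apply: gamma_le; [rewrite mulr_gt0 ?powR_gt0 | exact: H].
have := gamma_ge0 G M p.
case Ep : (gamma G M p) => [a| |] // a0; last first.
  by rewrite poweRyr ?gt_eqF // gt0_muley ?leey ?lte_fin.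
rewrite poweR_EFin -EFinM leNgt; apply/negP.
(* Any admissible constant for [p] shows that the infimum for [q] is finite. *)
have [|g _] := gamma_q_le (a + 1); first by rewrite Ep lte_fin ltrDl.
have := gamma_ge0 G M q.
case Eq : (gamma G M q) => [T| |] // _ _.
rewrite lte_fin => ltT; rewrite lee_fin in a0.
have ltTC : a `^ (q / p) < T / C by rewrite ltr_pdivlMr // mulrC.
have TC0 : 0 <= T / C by apply: le_trans (ltW ltTC); exact: powR_ge0.
have pow_inv x : 0 <= x -> (x `^ (q / p)) `^ (p / q) = x.
  by move=> x0; rewrite -powRrM mulrA divfK ?divff ?powRr1 ?gt_eqF.
have [|g' /andP[g'0 g'x]] := gamma_q_le ((T / C) `^ (p / q)).
  rewrite Ep lte_fin -[ltLHS]pow_inv // gt0_ltr_powR ?nnegrE ?powR_ge0 //.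
  by rewrite divr_gt0.
rewrite Eq lee_fin -ler_pdivrMl // mulrC leNgt => /negP; apply.
have <- : ((T / C) `^ (p / q)) `^ (q / p) = T / C by rewrite powRAC pow_inv.
by rewrite gt0_ltr_powR ?nnegrE ?powR_ge0 // ltW.
Qed.

Theorem theorem1p2 (R : realType) (d : nat) (h p q : R) :
  (3 <= d)%N -> 0 < h -> 0 < p -> p <= q ->
  exists C : R, 0 < C /\
    forall G : sgraph, regular G d -> cheeger R G = h%:E ->
    forall M : metricType R,
      (gamma G M p <= C%:E * Order.max 1 (gamma G M q))%E /\
      (gamma G M q <= C%:E * gamma G M p `^ (q / p))%E.
Proof.
move=> d3 h0 p0 pq; have d0 : (0 < d)%N by exact: leq_trans d3.
have q0 : 0 < q := lt_le_trans p0 pq.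
have [C1 C10 lower] := poincare_ineq_lower d0 h0 p0 pq.
have [C2 C20 upper] := poincare_ineq_upper d0 h0 p0 pq.
exists (C1 + C2); split; first exact: addr_gt0.
move=> G regG chG M; have n1 := cheeger_card_gt1 chG.
have expG := cheeger_expands chG.
have lower_le : (gamma G M p <= C1%:E * Order.max 1 (gamma G M q))%E.
  by apply: gamma_lower => // g g0; apply: lower => //; exact: ltnW.
have upper_le : (gamma G M q <= C2%:E * gamma G M p `^ (q / p))%E.
  by apply: gamma_upper => // g g0; exact: upper.
split.
  apply: le_trans lower_le _; apply: lee_wpmul2r.
    by rewrite le_max lee01.
  by rewrite lee_fin lerDl ltW.
apply: le_trans upper_le _; apply: lee_wpmul2r; first exact: poweR_ge0.
by rewrite lee_fin lerDr ltW.
Qed.
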